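(* There exists $n_0$ such that for every integer $n\geq n_0$, $\mathrm{ex}_2(n,\mathbf{F})=\lfloor n/2\rfloor$, where $\mathbf{F}$ is the Fano plane.
   Context: A $3$-graph is a $3$-uniform hypergraph (finite vertex set; edges are $3$-element subsets of distinct vertices). The Fano plane $\mathbf{F}$ is the $3$-graph on the seven vertices $a,x,y,z,x',y',z'$ with the seven edges $axx', ayy', azz', xyz', xy'z, x'yz, x'y'z'$. For a $3$-graph $G$ and two distinct vertices $u,v$, the co-degree $d(u,v)$ is the number of edges of $G$ containing both $u$ and $v$; the minimum co-degree $\delta_2(G)$ is the minimum of $d(u,v)$ over all pairs of distinct vertices. For a $3$-graph $H$, $\mathrm{ex}_2(n,H)$ is the maximum value of $\delta_2(G)$ over all $n$-vertex $3$-graphs $G$ that contain no copy of $H$ as a (not necessarily induced) subgraph. *)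

(* Defs.v *)
From HB Require Import structures.
From mathcomp Require Import all_boot.

Set Implicit Arguments.
Unset Strict Implicit.
Unset Printing Implicit Defensive.

Record threegraph (T : finType) := ThreeGraph {
  edges : {set {set T}};
  edges_card3 : [forall e in edges, #|e| == 3]
}.

HB.instance Definition _ (T : finType) := [isSub for @edges T].
HB.instance Definition _ (T : finType) := [Countable of threegraph T by <:].
HB.instance Definition _ (T : finType) := [Finite of threegraph T by <:].

Definition codegree (T : finType) (G : threegraph T) (u v : T) : nat :=
  #|[set e in edges G | (u \in e) && (v \in e)]|.

(* A codegree counts third vertices, so it is at most #|T| and the default
   #|T| of the big operator does not lower the minimum (see delta2_attained).
   The default is only returned when #|T| < 2, where there is no pair of
   distinct vertices. *)
Definition delta2 (T : finType) (G : threegraph T) : nat :=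
  \big[minn/#|T|]_(p : T * T | p.1 != p.2) codegree G p.1 p.2.

(* Copies are not necessarily induced. *)
Definition contains_copy (T U : finType) (G : threegraph T)
    (H : threegraph U) : bool :=
  [exists f : {ffun U -> T},
    injectiveb f && [forall e in edges H, f @: e \in edges G]].

(* \max over an empty family is 0; this is only met if H has no edge, since
   otherwise the edgeless 3-graph contains no copy of H. *)
Definition ex2 (n : nat) (U : finType) (H : threegraph U) : nat :=
  \max_(G : threegraph 'I_n | ~~ contains_copy G H) delta2 G.

Definition fano_edges : {set {set 'I_7}} :=
  let a  := @Ordinal 7 0 isT in
  let x  := @Ordinal 7 1 isT in
  let y  := @Ordinal 7 2 isT in
  let z  := @Ordinal 7 3 isT in
  let x' := @Ordinal 7 4 isT in
  let y' := @Ordinal 7 5 isT in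
  let z' := @Ordinal 7 6 isT in
  [set [set a; x; x']; [set a; y; y']; [set a; z; z'];
       [set x; y; z']; [set x; y'; z]; [set x'; y; z]; [set x'; y'; z']].

Lemma fano_card3 : [forall e in fano_edges, #|e| == 3].
Proof.
apply/forall_inP => e; rewrite !inE -!orbA.
by do 6?[case/orP]; move/eqP->; rewrite -setUA !cardsU1 cards1 !inE.
Qed.

Definition fano : threegraph 'I_7 := ThreeGraph fano_card3.

Lemma codegree_le (T : finType) (G : threegraph T) (u v : T) :
  u != v -> codegree G u v <= #|T|.
Proof.
move=> uv; rewrite /codegree -cardsT.
apply: leq_trans (leq_imset_card (fun w => [set u; v; w]) _).
apply/subset_leq_card/subsetP => e; rewrite !inE => /and3P[eG ue ve].
have /eqP e3 : #|e| == 3 by move/forall_inP: (edges_card3 G); apply.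
have suv : [set u; v] \subset e by rewrite subUset !sub1set ue ve.
have : #|e :\: [set u; v]| == 1.
  by rewrite cardsD (setIidPr suv) e3 cards2 uv.
case/cards1P=> w ew; apply/imsetP; exists w => //.
by rewrite -ew -[LHS](setID e [set u; v]) (setIidPr suv).
Qed.

Lemma delta2_le (T : finType) (G : threegraph T) (u v : T) :
  u != v -> delta2 G <= codegree G u v.
Proof.
move=> uv; have := mem_index_enum (u, v); rewrite /delta2.
elim: index_enum => // q r IHr; rewrite inE big_cons.
case/predU1P=> [<-|/IHr]; first by rewrite uv geq_minl.
by case: ifP => // _; apply: leq_trans (geq_minr _ _).
Qed.

Lemma delta2_attained (T : finType) (G : threegraph T) :
  1 < #|T| -> exists u v : T, u != v /\ delta2 G = codegree G u v.
Proof.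
case/card_gt1P=> u [v [_ _ uv]].
have [//|dT] : (exists x y : T, x != y /\ delta2 G = codegree G x y)
    \/ delta2 G = #|T|.
  rewrite {1 2}/delta2; elim/big_ind: _ => [|m n|[x y] /= xy].
  - by right.
  - by rewrite /minn; case: ltnP.
  - by left; exists x, y.
exists u, v; split=> //; apply/eqP.
by rewrite eqn_leq delta2_le //= dT codegree_le.
Qed.

(* Main.v *)
Require Import Defs.
From mathcomp Require Import all_boot all_order all_algebra.
From mathcomp Require Import zify.

(** Lower bound: split the vertices into two halves and take all triples meeting
    both.  Every pair is completed by at least floor(n/2) vertices, and the Fano
    plane is not contained because it has no 2-colouring without monochromatic
    line ([crossing_delta2], [crossing_fano_free]).

    Upper bound ([fano_of_codegree]): let every pair of vertices of G have codegree
    more than n/2.  A Fano plane appears as soon as a vertex v forms edges with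
    three disjoint pairs all of whose transversals are edges ([fano_of_pairs]).  So
    consider a bounded family of pairs, and on it the 3-graph h in which
    three pairs form an edge if all their transversals are edges of G.  If G has
    no Fano plane, the pairs that form an edge with a given v are an independent
    set of h.  Each pair forms an edge with more than n/2 vertices v, so these n
    independent sets cover every vertex of h more than n/2 times.  This bound is
    used without loss, which makes the result exact; the 3-graph h itself needs
    only approximate properties.

    It remains to choose the pairs so that h has no such cover.  It is enough that
    almost all pairs of vertices of h have codegree at least .49 |h|
    ([no_independent_half_cover]): then a cover of this kind forces h to resemble
    a complete bipartite 3-graph, hence to contain a complete 3-graph on four vertices, and
    no independent set contains more than two of these, so that they are covered
    at most n/2 times on average, a contradiction.

    Such an h is found by sampling.  A random bounded sample of vertices of G
    inherits codegrees close to one half, by a second moment computation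
    ([sampling]).  Some pattern h is therefore induced by a positive proportion of
    all samples, and a dense set of samples contains a box with two values in each
    coordinate ([boxes_in_dense_sets]): the two values of each coordinate are the
    desired pairs. *)

Set Implicit Arguments.
Unset Strict Implicit.
Unset Printing Implicit Defensive.
Import Order.TTheory GRing.Theory Num.Theory.

(** * Edges as triples of vertices, and the Fano plane *)

Definition adj (T : finType) (G : threegraph T) (u v w : T) : bool :=
  [set u; v; w] \in edges G.

Lemma adjCr (T : finType) (G : threegraph T) u v w : adj G u v w = adj G u w v.
Proof. by rewrite /adj -!setUA [[set v] :|: _]setUC. Qed.

Lemma adjCl (T : finType) (G : threegraph T) u v w : adj G u v w = adj G v u w.
Proof. by rewrite /adj [[set u] :|: _]setUC. Qed.

Lemma adj_uniq (T : finType) (G : threegraph T) u v w :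
  adj G u v w -> [&& u != v, u != w & v != w].
Proof.
move=> uvw; have /forall_inP/(_ _ uvw) := edges_card3 G.
rewrite -setUA !cardsU1 cards1 !inE negb_or.
by case: (u == v); case: (u == w); case: (v == w).
Qed.

Lemma codegree_adj (T : finType) (G : threegraph T) (u v : T) :
  u != v -> codegree G u v <= #|[set w | adj G u v w]|.
Proof.
move=> uv; rewrite /codegree.
apply: leq_trans (leq_imset_card (fun w => [set u; v; w]) _).
apply/subset_leq_card/subsetP => e; rewrite !inE => /and3P[eG ue ve].
have /eqP e3 : #|e| == 3 by move/forall_inP: (edges_card3 G); apply.
have suv : [set u; v] \subset e by rewrite subUset !sub1set ue ve.
have : #|e :\: [set u; v]| == 1.
  by rewrite cardsD (setIidPr suv) e3 cards2 uv.
case/cards1P=> w ew.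
have ee : e = [set u; v; w] by rewrite -ew -[LHS](setID e [set u; v]) (setIidPr suv).
by apply/imsetP; exists w => //; rewrite inE /adj -ee.
Qed.

(** The decomposition of the Fano plane used throughout: the vertex [v] is the
    point a, the three pairs are xx', yy', zz', and the four lines avoiding a are
    transversals of the three pairs.  All eight transversals are assumed, because
    the box argument delivers them together. *)
Lemma fano_of_pairs (T : finType) (G : threegraph T) (v : T) (p q : bool -> T)
    (r : bool -> T) :
  adj G v (p true) (p false) -> adj G v (q true) (q false) ->
  adj G v (r true) (r false) ->
  (forall b c d, adj G (p b) (q c) (r d)) -> contains_copy G fano.
Proof.
move=> vp vq vr pqr.
pose s := [:: v; p true; q true; r true; p false; q false; r false].
apply/existsP; exists [ffun i : 'I_7 => nth v s i]; apply/andP; split.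
  apply/injectiveP => i j; rewrite !ffunE => /eqP.
  rewrite nth_uniq ?ltn_ord //; first by move/eqP/val_inj.
  have /and3P[a1 a2 a3] := adj_uniq vp.
  have /and3P[b1 b2 b3] := adj_uniq vq.
  have /and3P[c1 c2 c3] := adj_uniq vr.
  have d b c e := adj_uniq (pqr b c e).
  have {d} : forall b c e, [/\ p b != q c, p b != r e & q c != r e].
    by move=> b c e; case/and3P: (d b c e).
  move=> d.
  have e1 b c : p b != q c by case: (d b c true).
  have e2 b c : p b != r c by case: (d b true c).
  have e3 b c : q b != r c by case: (d true b c).
  rewrite /s /= !inE !negb_or a1 a2 a3 b1 b2 b3 c1 c2 c3 !e1 !e2 !e3 /=.
  by rewrite ![q _ == p _]eq_sym ![r _ == p _]eq_sym ![r _ == q _]eq_sym !e1 !e2 !e3.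
apply/forall_inP => e; rewrite !inE -!orbA.
have im3 (f : {ffun 'I_7 -> T}) a b c : f @: [set a; b; c] = [set f a; f b; f c].
  by rewrite !imsetU !imset_set1.
have := pqr; rewrite /adj => h.
by do 6?[case/orP]; move/eqP->; rewrite im3 !ffunE /=.
Qed.

(** * The bipartite construction *)

Lemma fano_not_2colorable (c : 'I_7 -> bool) :
  exists2 e, e \in fano_edges & {in e &, forall i j, c i = c j}.
Proof.
pose a  := @Ordinal 7 0 isT.
pose x  := @Ordinal 7 1 isT.
pose y  := @Ordinal 7 2 isT.
pose z  := @Ordinal 7 3 isT.
pose x' := @Ordinal 7 4 isT.
pose y' := @Ordinal 7 5 isT.
pose z' := @Ordinal 7 6 isT.
have mono i j k : c i = c j -> c j = c k ->
    {in [set i; j; k] &, forall i j, c i = c j}.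
  move=> ij jk s t; rewrite !inE -!orbA.
  by case/or3P=> /eqP-> /or3P[]/eqP->; congruence.
suff [[i [j k]] /=] : exists t : 'I_7 * ('I_7 * 'I_7),
   [set t.1; t.2.1; t.2.2] \in fano_edges /\ (c t.1 = c t.2.1 /\ c t.2.1 = c t.2.2).
  by case=> h [ij jk]; exists [set i; j; k] => //; apply: mono.
suff : [\/ c a = c x /\ c x = c x', c a = c y /\ c y = c y',
           c a = c z /\ c z = c z' |
        [\/ c x = c y /\ c y = c z', c x = c y' /\ c y' = c z,
           c x' = c y /\ c y = c z | c x' = c y' /\ c y' = c z']].
  case=> [h|h|h|[]h]; [exists (a, (x, x'))|exists (a, (y, y'))|exists (a, (z, z'))
   |exists (x, (y, z'))|exists (x, (y', z))|exists (x', (y, z))|exists (x', (y', z'))];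
   by split=> //; rewrite !inE eqxx ?orbT.
case: (c a); case: (c x); case: (c y); case: (c z); case: (c x'); case: (c y'); case: (c z');
  by [constructor 1|constructor 2|constructor 3|constructor 4; constructor 1|
   constructor 4; constructor 2|constructor 4; constructor 3|constructor 4; constructor 4].
Qed.

(** The extremal example: all triples meeting both [A] and its complement. *)
Definition crossing_edges (T : finType) (A : {set T}) : {set {set T}} :=
  [set e : {set T} | [&& #|e| == 3, ~~ (e \subset A) & ~~ (e \subset ~: A)]].

Lemma crossing_card3 (T : finType) (A : {set T}) :
  [forall e in crossing_edges A, #|e| == 3].
Proof. by apply/forall_inP => e; rewrite inE => /and3P[]. Qed.

Definition crossing (T : finType) (A : {set T}) : threegraph T :=
  ThreeGraph (crossing_card3 A).

(** A copy of the Fano plane would pull the bipartition back to a 2-colouring of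
    its points without monochromatic line. *)
Lemma crossing_fano_free (T : finType) (A : {set T}) :
  ~~ contains_copy (crossing A) fano.
Proof.
apply/existsP => -[f /andP[_ /forall_inP fE]].
have [e eF mono] := fano_not_2colorable (fun i => f i \in A).
have /= := fE e eF; rewrite inE => /and3P[_ /subsetPn[_ /imsetP[i ie ->] iA]].
case/subsetPn=> _ /imsetP[j je ->]; rewrite inE negbK -(mono i j ie je).
by rewrite (negPf iA).
Qed.

Lemma crossing_codegree (T : finType) (A : {set T}) (u v : T) (D : {set T}) :
  u != v -> (forall w, w \in D -> adj (crossing A) u v w) ->
  #|D| <= codegree (crossing A) u v.
Proof.
move=> uv DE; rewrite -(card_in_imset (f := fun w => [set u; v; w]) (D := mem D)).
  apply/subset_leq_card/subsetP => _ /imsetP[w /DE wE ->].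
  by rewrite inE [_ \in edges _]wE !inE !eqxx ?orbT.
move=> w w' /DE/adj_uniq/and3P[_ uw vw] /DE/adj_uniq/and3P[_ uw' vw'] /setP/(_ w).
by rewrite !inE eqxx orbT ![w == _]eq_sym (negPf uw) (negPf vw) => /esym/eqP.
Qed.

Lemma adj_crossing (T : finType) (A : {set T}) (u v w : T) :
  [&& u != v, u != w & v != w] ->
  adj (crossing A) u v w =
    ~~ [&& u \in A, v \in A & w \in A] && [|| u \in A, v \in A | w \in A].
Proof.
case/and3P=> uv uw vw; rewrite /adj /crossing /= inE -setUA !cardsU1 cards1 !inE.
rewrite negb_or uv uw vw /= !subUset !sub1set !inE.
by case: (u \in A); case: (v \in A); case: (w \in A).
Qed.

(** A pair inside one class is completed by the whole other class, and a pair
    across the classes by every other vertex; the hypothesis [d.+2 <= #|T|] is for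
    the second kind. *)
Lemma crossing_delta2 (T : finType) (A : {set T}) (d : nat) :
  d <= #|A| -> d <= #|~: A| -> d.+2 <= #|T| -> d <= delta2 (crossing A).
Proof.
move=> dA dA' dT.
have [|u [v [uv ->]]] := @delta2_attained _ (crossing A); first by lia.
case uA: (u \in A); case vA: (v \in A).
- apply: leq_trans dA' (crossing_codegree uv _) => w; rewrite inE => wA.
  rewrite adj_crossing ?uA ?vA ?(negPf wA) // uv /=.
  by apply/andP; split; apply: contraNneq wA => <-.
- have : d <= #|[set: T] :\ u :\ v|.
    by move: dT; rewrite -cardsT (cardsD1 u) (cardsD1 v) !inE eq_sym uv /=; lia.
  move/leq_trans; apply; apply: (crossing_codegree uv) => w.
  rewrite !inE andbT => /andP[wv wu].
  by rewrite adj_crossing ?uA ?vA // uv ![_ == w]eq_sym wu wv.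
- have : d <= #|[set: T] :\ u :\ v|.
    by move: dT; rewrite -cardsT (cardsD1 u) (cardsD1 v) !inE eq_sym uv /=; lia.
  move/leq_trans; apply; apply: (crossing_codegree uv) => w.
  rewrite !inE andbT => /andP[wv wu].
  by rewrite adj_crossing ?uA ?vA // uv ![_ == w]eq_sym wu wv.
- apply: leq_trans dA (crossing_codegree uv _) => w wA.
  rewrite adj_crossing ?uA ?vA ?wA // uv /=.
  by apply/andP; split; apply/eqP => /esym h; move: wA; rewrite h ?uA ?vA.
Qed.

(** * Boxes in dense sets of functions *)

Definition upd (I V : finType) (x : {ffun I -> V}) (k : I) (y : V) :
    {ffun I -> V} := [ffun j => if j == k then y else x j].

(** Redrawing the coordinate [k] of a uniform point of [V ^ I] leaves it uniform.
    This is the only form of independence of coordinates needed below. *)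
Lemma sum_upd (I V : finType) (R : nmodType) (k : I) (F : {ffun I -> V} -> R) :
  (\sum_x \sum_y F (upd x k y) = (\sum_x F x) *+ #|V|)%R.
Proof.
(* Exchanging the new value with the one it replaces is an involution. *)
pose h (t : {ffun I -> V} * V) := (upd t.1 k t.2, t.1 k).
have hK : involutive h.
  move=> [x y]; rewrite /h /upd /= ffunE eqxx; congr pair.
  by apply/ffunP => j; rewrite !ffunE; case: eqP => [->|].
rewrite pair_big /= (reindex_inj (inv_inj hK)).
under eq_bigr do rewrite -[upd _ _ _]/(h (h _)).1 hK.
rewrite -(pair_bigA _ (fun x y => F x)) /= -sumrMnl.
by apply: eq_bigr => x _; rewrite sumr_const.
Qed.

Lemma sum_upd_nat (I V : finType) (k : I) (F : {ffun I -> V} -> nat) :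
  \sum_x \sum_y F (upd x k y) = #|V| * \sum_x F x.
Proof.
have := sum_upd k F; rewrite -mulr_natr natn => E.
by rewrite mulnC; exact: E.
Qed.

(** By Cauchy-Schwarz, two independent values for the coordinate [k] both keep a
    point in [S] with probability at least 1/C^2.  They coincide with probability
    only 1/|V|, so for large [V] some two distinct values do so for a proportion
    1/(2 C^2) of the points. *)
Lemma box_step (I V : finType) (S : {set {ffun I -> V}}) (k : I) (C : nat) :
  0 < #|V| -> 2 * C ^ 2 <= #|V| -> #|{ffun I -> V}| <= C * #|S| ->
  exists y z, y != z /\ #|{ffun I -> V}| <=
    2 * C ^ 2 * #|[set x | (upd x k y \in S) && (upd x k z \in S)]|.
Proof.
set n := #|V|; set t := #|{ffun I -> V}| => n0 nC tS.
have t0 : 0 < t by rewrite /t card_ffun expn_gt0 n0.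
pose W y z := #|[set x | (upd x k y \in S) && (upd x k z \in S)]|.
pose deg x := \sum_(y : V) (upd x k y \in S).
have sdeg : \sum_x deg x = n * #|S|.
  by rewrite (sum_upd_nat k (fun x => (x \in S) : nat)) -sum1_card [in RHS]big_mkcond.
have sdeg2 : \sum_x deg x ^ 2 = \sum_y \sum_z W y z.
  transitivity (\sum_x \sum_y \sum_z ((upd x k y \in S) && (upd x k z \in S) : nat)).
    apply: eq_bigr => x _; rewrite -mulnn big_distrl /=; apply: eq_bigr => y _.
    by rewrite big_distrr /=; apply: eq_bigr => z _; rewrite mulnb.
  rewrite exchange_big; apply: eq_bigr => y _; rewrite exchange_big.
  apply: eq_bigr => z _; rewrite /W -sum1_card [in RHS]big_mkcond /=.
  by apply: eq_bigr => x _; rewrite inE.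
(* Cauchy-Schwarz, summed from 2 n (C deg) <= n^2 + (C deg)^2. *)
have cs : n ^ 2 * t <= C ^ 2 * \sum_x deg x ^ 2.
  have : \sum_x 2 * (n * (C * deg x)) <= \sum_(x : {ffun I -> V}) (n ^ 2 + C ^ 2 * deg x ^ 2).
    by apply: leq_sum => x _; rewrite -expnMn; exact: nat_Cauchy.
  have -> : \sum_(x : {ffun I -> V}) (n ^ 2 + C ^ 2 * deg x ^ 2)
      = t * n ^ 2 + C ^ 2 * \sum_x deg x ^ 2.
    by rewrite big_split /= -sum_nat_const big_distrr.
  rewrite -!big_distrr /= sdeg.
  have : n * (n * t) <= n * (n * (C * #|S|)) by rewrite !leq_mul.
  have -> : n * (C * (n * #|S|)) = n * (n * (C * #|S|)) by rewrite (mulnCA C).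
  have -> : n ^ 2 * t = n * (n * t) by rewrite -mulnn mulnA.
  by rewrite (mulnC t) -mulnn -mulnA; lia.
case: (pickP [pred yz : V * V | (yz.1 != yz.2) && (t <= 2 * C ^ 2 * W yz.1 yz.2)]).
  by case=> y z /= /andP[yz h]; exists y, z.
move=> none; exfalso.
(* Otherwise each off-diagonal pair contributes less than t, and the diagonal
   ones at most 2 C^2 n t <= n^2 t in all: too little for cs. *)
have Wle y z : 2 * C ^ 2 * W y z <= if y == z then n * t else t.
  case: eqP => [_|/eqP yz]; first by rewrite leq_mul // max_card.
  by have := none (y, z); rewrite /= yz /=; lia.
have : 2 * (n ^ 2 * t) <= \sum_(y : V) \sum_(z : V) (if y == z then n * t else t).
  apply: (@leq_trans (2 * C ^ 2 * \sum_x deg x ^ 2)); first by rewrite -mulnA leq_mul2l.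
  rewrite sdeg2 big_distrr; apply: leq_sum => y _; rewrite big_distrr.
  by apply: leq_sum => z _; apply: Wle.
have -> : \sum_(y : V) \sum_(z : V) (if y == z then n * t else t) = n * (n * t + n.-1 * t).
  transitivity (\sum_(y : V) (n * t + n.-1 * t)); last exact: (sum_nat_const V).
  apply: eq_bigr => y _.
  rewrite (bigD1 y) //= eqxx; congr (_ + _).
  rewrite (eq_bigr (fun=> t)); last by move=> z; rewrite eq_sym => /negPf->.
  by rewrite sum_nat_const -(cardC1 y).
by case: n n0 {nC sdeg cs none Wle} => // n _; rewrite -pred_Sn; nia.
Qed.

(** A dense subset of [V ^ I] contains a combinatorial box with two distinct
    values in each direction [k \in s]: the coordinates are doubled one at a time by
    [box_step], and the density remains bounded below.  Applied to the set of
    embeddings of a fixed pattern it produces a blow-up of this pattern in which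
    every vertex is replaced by two. *)
Lemma boxes_in_dense_sets (I : finType) (s : seq I) (C : nat) :
  exists N, forall (V : finType) (S : {set {ffun I -> V}}),
    N <= #|V| -> #|{ffun I -> V}| <= C * #|S| ->
    exists (p q : I -> V) (x : {ffun I -> V}),
      (forall k, k \in s -> p k != q k) /\
      forall b : I -> bool,
        [ffun k => if k \in s then if b k then p k else q k else x k] \in S.
Proof.
elim: s C => [|k s IH] C.
  exists 1 => V S V0 tS.
  have : 0 < #|S|.
    have : 0 < #|{ffun I -> V}| by rewrite card_ffun expn_gt0 V0.
    by move/leq_trans/(_ tS); rewrite muln_gt0 => /andP[].
  case/card_gt0P=> x xS; exists x, x, x; split=> // b.
  by rewrite (_ : finfun _ = x) //; apply/ffunP => k; rewrite ffunE in_nil.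
have [N HN] := IH (2 * C ^ 2); exists (maxn 1 (maxn N (2 * C ^ 2))) => V S.
rewrite !geq_max => /and3P[V0 NV CV] tS.
have [y [z [yz]]] := box_step k V0 CV tS; move/(HN _ _ NV) => [p [q [x [pq mix]]]].
exists (fun j => if j == k then y else p j), (fun j => if j == k then z else q j), x.
split=> [j|b]; first by rewrite inE; case: eqP => //= _ /pq.
have := mix b; rewrite inE => /andP[my mz].
rewrite (_ : finfun _ = upd [ffun k => if k \in s then if b k then p k else q k else x k] k
  (if b k then y else z)); first by case: (b k).
by apply/ffunP => j; rewrite !ffunE inE; case: (eqVneq j k) => [->|].
Qed.

(** * Codegrees in a random sample *)

Definition codeg (J : finType) (h : J -> J -> J -> bool) (i j : J) : nat :=
  #|[set k | h i j k]|.

(** Pairs whose codegree is noticeably below one half.  Sampling cannot preserve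
    the bound 1/2 itself, and 49/100 leaves enough room in the counting of
    [no_independent_half_cover]. *)
Definition deficient (J : finType) (h : J -> J -> J -> bool) : {set J * J} :=
  [set ij | 100 * codeg h ij.1 ij.2 < 49 * #|J|].

(** The 3-graph on the indices induced by a sample [x] of vertices, taken with
    repetition. *)
Definition pull (J V : finType) (e : V -> V -> V -> bool) (x : {ffun J -> V})
  (i j k : J) : bool := e (x i) (x j) (x k).

(** The contribution of the sampled vertex [x k] to the deviation of the codegree
    of [i], [j] in the sample from its expectation, multiplied by |V| to remain
    integral; it has mean zero over the choice of [x k]. *)
Definition codeg_dev (J V : finType) (e : V -> V -> V -> bool) (i j : J)
    (x : {ffun J -> V}) (k : J) : int :=
  ((#|V|)%:R * (e (x i) (x j) (x k))%:R - (codeg e (x i) (x j))%:R)%R.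

Lemma codeg_dev_upd_sum (J V : finType) (e : V -> V -> V -> bool) (i j k : J)
    (x : {ffun J -> V}) : k != i -> k != j ->
  (\sum_y codeg_dev e i j (upd x k y) k = 0)%R.
Proof.
move=> ki kj; rewrite /codeg_dev sumrB -big_distrr /=.
under eq_bigr do rewrite !ffunE eqxx ![_ == k]eq_sym (negPf ki) (negPf kj).
under [X in (_ - X)%R]eq_bigr do rewrite !ffunE ![_ == k]eq_sym (negPf ki) (negPf kj).
rewrite sumr_const -natr_sum.
rewrite (_ : \sum_y _ = codeg e (x i) (x j)) ?mulr_natl ?subrr //.
by rewrite /codeg -sum1_card [RHS]big_mkcond; apply: eq_bigr => y _; rewrite inE; case: ifP.
Qed.

Lemma codeg_dev_sq (J V : finType) (e : V -> V -> V -> bool) (i j k : J) (x : {ffun J -> V}) :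
  (codeg_dev e i j x k * codeg_dev e i j x k <= (#|V| ^ 2)%:R)%R.
Proof.
have : codeg e (x i) (x j) <= #|V| by exact: max_card.
rewrite /codeg_dev; move: (codeg _ _ _) #|V| (e _ _ _) => d n [] dn /=; rewrite ?mulr1 ?mulr0.
  by rewrite -natrB // -natrM ler_nat -mulnn leq_mul // leq_subr.
by rewrite sub0r mulrNN -natrM ler_nat -mulnn leq_mul.
Qed.

(** Conditionally on [x i] and [x j] the summands are independent and centred, so
    only the diagonal terms of the expanded square survive. *)
Lemma variance (J V : finType) (e : V -> V -> V -> bool) (i j : J) :
  0 < #|V| ->
  (\sum_(x : {ffun J -> V}) (\sum_(k | (k != i) && (k != j)) codeg_dev e i j x k) ^+ 2
    <= (#|J| * (#|V| ^ 2 * #|{ffun J -> V}|))%:R)%R.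
Proof.
move=> V0; pose P k := (k != i) && (k != j).
under eq_bigr do rewrite expr2 big_distrl /=.
rewrite exchange_big /=.
have term k : P k ->
  (\sum_(x : {ffun J -> V}) codeg_dev e i j x k * (\sum_(l | P l) codeg_dev e i j x l)
    <= (#|V| ^ 2 * #|{ffun J -> V}|)%:R)%R.
  case/andP=> ki kj.
  rewrite (eq_bigr (fun x => codeg_dev e i j x k * codeg_dev e i j x k +
     \sum_(l | P l && (l != k)) codeg_dev e i j x k * codeg_dev e i j x l)%R); last first.
    by move=> x _; rewrite (bigD1 k) /= ?mulrDr ?big_distrr // /P ki kj.
  rewrite big_split /= [X in (_ + X)%R]exchange_big /= [X in (_ + X)%R]big1 => [|l].
    rewrite addr0 natrM mulr_natr -sumr_const; apply: ler_sum => x _; exact: codeg_dev_sq.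
  case/andP=> /andP[li lj] lk.
  suff : ((\sum_x codeg_dev e i j x k * codeg_dev e i j x l) *+ #|V| = 0 :> int)%R.
    by move/eqP; rewrite mulrn_eq0 -[#|V| == 0]negbK -lt0n V0 /= => /eqP.
  (* Redraw x k: only the factor codeg_dev ... k depends on it. *)
  rewrite -(sum_upd k); apply: big1 => x _.
  rewrite (eq_bigr (fun y => codeg_dev e i j (upd x k y) k * codeg_dev e i j x l)%R); last first.
    by move=> y _; congr (_ * _)%R; rewrite /codeg_dev !ffunE (negPf lk) ![_ == k]eq_sym (negPf ki) (negPf kj).
  by rewrite -big_distrl /= codeg_dev_upd_sum ?mul0r.
apply: (@le_trans _ _ (\sum_(k | P k) (#|V| ^ 2 * #|{ffun J -> V}|)%:R)%R).
  exact: ler_sum.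
rewrite sumr_const -[(_ *+ #|_|)%R]mulr_natl -natrM ler_nat leq_mul2r.
by rewrite max_card orbT.
Qed.

(** Chebyshev's inequality: a deficient pair with distinct values misses its
    expected codegree, at least (m - 2) / 2, by at least m / 200. *)
Lemma chebyshev (J V : finType) (e : V -> V -> V -> bool) (i j : J) :
  0 < #|V| -> 200 <= #|J| ->
  (forall u w, u != w -> #|V| <= 2 * codeg e u w) ->
  #|J| * #|[set x : {ffun J -> V} | (x i != x j) && ((i, j) \in deficient (pull e x))]|
   <= 200 * 200 * #|{ffun J -> V}|.
Proof.
move=> V0 J200 eV; set B := [set x | _]; set m := #|J|; set n := #|V|.
set t := #|{ffun J -> V}|.
suff : (m ^ 2 * n ^ 2) * #|B| <= (200 * 200) * (m * (n ^ 2 * t)).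
  move=> le; rewrite -(@leq_pmul2l (m * n ^ 2)); last by rewrite muln_gt0 expn_gt0 V0 (leq_trans _ J200).
  apply: leq_trans (leq_trans le _); first by rewrite -[m ^ 2]mulnn; lia.
  by lia.
have := variance e i j V0; rewrite -/m -/n -/t.
move=> var.
suff : (((m ^ 2 * n ^ 2) * #|B|)%:R <= (200 * 200)%:R * \sum_(x : {ffun J -> V}) (\sum_(k | (k != i) && (k != j)) codeg_dev e i j x k) ^+ 2 :> int)%R.
  move: var; move: (\sum_x _)%R => z; lia.
rewrite natrM mulr_natr -sumr_const big_distrr /=.
rewrite [X in (_ <= X)%R](bigID (mem B)) /= -[X in (X <= _)%R]addr0.
apply: lerD; last by apply: sumr_ge0 => x _; apply: mulr_ge0; [exact: ler0n|exact: sqr_ge0].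
apply: ler_sum => x; rewrite !inE => /andP[/eV xV lt].
set D := (\sum_(k | _) _)%R.
suff le : (200%:R * D <= - (m * n)%:R)%R.
  rewrite -expnMn natrX [(200 * 200)%:R%R]natrM -expr2 -exprMn -(sqrrN (_ * D)).
  have le' : ((m * n)%:R <= - (200%:R * D))%R by rewrite lerNr.
  by rewrite lerXn2r ?nnegrE ?(le_trans _ le') ?ler0n.
pose P k := (k != i) && (k != j).
have cP : m <= #|P| + 2.
  have := cardC P; rewrite -/m => <-; rewrite leq_add2l.
  apply: (@leq_trans #|[set i; j]|); last by rewrite cards2; case: (_ != _).
  by apply/subset_leq_card/subsetP => k; rewrite !inE -[k \in P]/((k != i) && (k != j)) negb_and !negbK.
have sumE : (\sum_(k | P k) (e (x i) (x j) (x k))%:R <= (codeg (pull e x) i j)%:R :> int)%R.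
  rewrite /codeg -sum1_card natr_sum big_mkcond [X in (_ <= X)%R]big_mkcond /=.
  apply: ler_sum => k _; rewrite inE /pull; by case: (P k); case: (e _ _ _).
have DE : D = (n%:R * (\sum_(k | P k) (e (x i) (x j) (x k))%:R) - #|P|%:R * (codeg e (x i) (x j))%:R)%R.
  rewrite /D /codeg_dev sumrB -big_distrr; congr (_ - _)%R.
  rewrite mulr_natl; exact: (sumr_const P).
move: sumE DE lt xV; rewrite /= -/m -/n.
move: (\sum_(k | P k) _)%R (codeg _ _ _) (codeg _ _ _) => s d c sc -> lt xV.
have h1 : (n%:R * s <= n%:R * c%:R :> int)%R by exact: (ler_wpM2l (ler0n _ n) sc).
have h2 : n * m <= 2 * (d * #|P|) + 2 * n.
  apply: (@leq_trans (n * (#|P| + 2))); first by rewrite leq_mul2l cP orbT.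
  by rewrite mulnDr mulnA (mulnC n 2) leq_add2r leq_mul2r xV orbT.
have h3 : n * (100 * c) <= n * (49 * m) by rewrite leq_mul2l ltnW ?orbT.
have h4 : n * 200 <= n * m by rewrite leq_mul2l J200 orbT.
move: h1 h2 h3 h4; clear; move: #|P| n m => p n m.
lia.
Qed.

Lemma card_coincide (J V : finType) (i j : J) : i != j ->
  #|V| * #|[set x : {ffun J -> V} | x i == x j]| = #|{ffun J -> V}|.
Proof.
move=> ij; rewrite -sum1_card big_mkcond -(sum_upd_nat i) -sum1_card.
apply: eq_bigr => x _; rewrite (bigD1 (x j)) //= big1 => [|y yx].
  by rewrite inE !ffunE eqxx [j == i]eq_sym (negPf ij) eqxx.
by rewrite inE !ffunE eqxx [j == i]eq_sym (negPf ij) (negPf yx).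
Qed.

(** Each of the two reasons for being deficient, a repeated vertex and a large
    deviation, has probability at most 1/600. *)
Lemma rarely_deficient (J V : finType) (e : V -> V -> V -> bool) (i j : J) :
  i != j -> 600 <= #|V| -> 600 * (200 * 200) <= #|J| ->
  (forall u w, u != w -> #|V| <= 2 * codeg e u w) ->
  300 * #|[set x : {ffun J -> V} | (i, j) \in deficient (pull e x)]| <= #|{ffun J -> V}|.
Proof.
move=> ij V600 Jbig eV; set B := [set x | _].
set C := [set x : {ffun J -> V} | x i == x j].
set D := [set x : {ffun J -> V} | (x i != x j) && ((i, j) \in deficient (pull e x))].
have BCD : #|B| <= #|C| + #|D|.
  apply: leq_trans (leq_card_setU _ _); apply/subset_leq_card/subsetP => x.
  by rewrite in_setU ![x \in [set _ | _]]in_set => ->; case: (x i == x j).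
have cC : #|V| * #|C| = #|{ffun J -> V}| := card_coincide V ij.
have cD : #|J| * #|D| <= (200 * 200) * #|{ffun J -> V}|.
  by apply: chebyshev; [lia | lia | exact: eV].
have {cC} hC : 600 * #|C| <= #|{ffun J -> V}| by rewrite -cC leq_mul2r V600 orbT.
have {cD} hD : 600 * #|D| <= #|{ffun J -> V}|.
  rewrite -(@leq_pmul2l (200 * 200)) //.
  by apply: leq_trans cD; rewrite mulnA leq_mul2r [200 * 200 * 600]mulnC Jbig orbT.
by move: hC hD BCD; clear; move: #|C| #|D| #|B| #|{ffun J -> V}|; lia.
Qed.

(** By [rarely_deficient] a random sample has at most m^2/200 deficient pairs on average
    (the diagonal ones are counted with their trivial bound m), and
    Markov's inequality gives at most m^2/100 of them in half of the samples. *)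
Lemma sampling (J V : finType) (e : V -> V -> V -> bool) :
  600 <= #|V| -> 600 * (200 * 200) <= #|J| ->
  (forall u w, u != w -> #|V| <= 2 * codeg e u w) ->
  #|{ffun J -> V}| <=
    2 * #|[set x : {ffun J -> V} | 100 * #|deficient (pull e x)| <= #|J| ^ 2]|.
Proof.
move=> V600 Jbig eV; set S := [set x | _]; set t := #|{ffun J -> V}|; set m := #|J|.
have m600 : 600 <= m by lia.
have total : \sum_(x : {ffun J -> V}) 300 * #|deficient (pull e x)| <= 300 * (m * t) + m ^ 2 * t.
  have -> : \sum_(x : {ffun J -> V}) 300 * #|deficient (pull e x)| =
      \sum_i \sum_j 300 * #|[set x : {ffun J -> V} | (i, j) \in deficient (pull e x)]|.
    rewrite pair_big /= -!big_distrr; congr (_ * _).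
    transitivity (\sum_(x : {ffun J -> V}) \sum_(ij : J * J) (ij \in deficient (pull e x) : nat)).
      by apply: eq_bigr => x _; rewrite -sum1_card big_mkcond.
    rewrite exchange_big; apply: eq_bigr => -[i j] _.
    by rewrite -sum1_card [RHS]big_mkcond; apply: eq_bigr => x _; rewrite in_set.
  have -> : 300 * (m * t) + m ^ 2 * t = \sum_(i : J) (300 * t + m * t).
    transitivity (#|J| * (300 * t + m * t)); first by rewrite -/m; lia.
    by rewrite -(sum_nat_const J).
  apply: leq_sum => i _; rewrite (bigD1 i) //=.
  apply: leq_add; first by rewrite leq_mul2l max_card.
  apply: (@leq_trans (\sum_(j | j != i) t)).
    by apply: leq_sum => j ji; apply: rarely_deficient; rewrite // eq_sym.
  by rewrite sum_nat_const leq_mul2r max_card orbT.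
have : \sum_(x : {ffun J -> V}) 3 * m ^ 2 * (x \notin S) <= 300 * (m * t) + m ^ 2 * t.
  apply: leq_trans total; apply: leq_sum => x _; rewrite inE -/m.
  by case: leqP => [_|] /=; rewrite ?muln0 ?muln1; move: #|deficient (pull e x)| (m ^ 2); lia.
rewrite -big_distrr /=.
have -> : \sum_(x : {ffun J -> V}) (x \notin S) = t - #|S|.
  rewrite -[t](cardsC S) addKn -sum1_card [RHS]big_mkcond.
  by apply: eq_bigr => x _; rewrite in_setC; case: ifP.
have : 600 * (m * t) <= m ^ 2 * t by rewrite -mulnn -mulnA leq_mul2r m600 orbT.
have : 0 < m ^ 2 by rewrite expn_gt0; lia.
move: #|S| (m ^ 2) (m * t) => s q p q0 h1 h2.
have : 2 * q * (3 * (t - s)) <= 2 * q * (2 * t) - q * t by lia.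
nia.
Qed.

(** * Covers by independent sets *)

Lemma exists_sum_ge (T : finType) (F : T -> nat) (c : nat) :
  0 < #|T| -> #|T| * c <= \sum_x F x -> exists x, c <= F x.
Proof.
move=> T0 le; apply/existsP; apply: contraLR le; rewrite negb_exists => /forallP F_lt.
rewrite -ltnNge -sum_nat_const.
case/card_gt0P: T0 => x0 _; rewrite (bigD1 x0) // [ltnRHS](bigD1 x0) //= -addSn.
apply: leq_add; first by rewrite ltnNge F_lt.
by apply: leq_sum => x _; apply: ltnW; rewrite ltnNge F_lt.
Qed.

Lemma sum_cardI (J V : finType) (I : V -> {set J}) (B : {set J}) :
  \sum_v #|I v :&: B| = \sum_(i in B) #|[set v | i \in I v]|.
Proof.
transitivity (\sum_v \sum_(i in B) (i \in I v : nat)).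
  apply: eq_bigr => v _; rewrite -sum1_card [RHS]big_mkcond [LHS]big_mkcond /=.
  by apply: eq_bigr => i _; rewrite inE andbC; case: (i \in B); case: (i \in I v).
rewrite exchange_big; apply: eq_bigr => i _.
by rewrite -sum1_card [RHS]big_mkcond; apply: eq_bigr => v _; rewrite inE; case: ifP.
Qed.

Lemma exists_cover (J V : finType) (I : V -> {set J}) (B : {set J}) :
  0 < #|V| -> (forall i, #|V| < 2 * #|[set v | i \in I v]|) ->
  exists v, #|B| <= 2 * #|I v :&: B|.
Proof.
move=> V0 cov; apply: exists_sum_ge => //; rewrite -big_distrr sum_cardI big_distrr /=.
rewrite mulnC -sum_nat_const; apply: leq_sum => i _; exact: ltnW.
Qed.

(** Four indices are covered more than twice on average, so some member of the
    cover contains three of them; these would form an edge of a complete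
    3-graph on the four indices. *)
Lemma half_cover_no_K4 (J V : finType) (I : V -> {set J}) (h : J -> J -> J -> bool) a b c d :
  0 < #|V| -> (forall i, #|V| < 2 * #|[set v | i \in I v]|) ->
  (forall v i j k, i \in I v -> j \in I v -> k \in I v -> ~~ h i j k) ->
  ~~ [&& h a b c, h a b d, h c d a & h c d b].
Proof.
move=> V0 cov indep; apply/negP => /and4P[abc abd cda cdb].
have [v] : exists v, 3 <= (a \in I v) + (b \in I v) + (c \in I v) + (d \in I v).
  have E i : \sum_v (i \in I v) = #|[set v | i \in I v]|.
    by rewrite -sum1_card [RHS]big_mkcond; apply: eq_bigr => v _; rewrite inE; case: ifP.
  case: (pickP (fun v => 3 <= (a \in I v) + (b \in I v) + (c \in I v) + (d \in I v))).
    by move=> v hv; exists v.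
  move=> none; exfalso.
  have : \sum_v ((a \in I v) + (b \in I v) + (c \in I v) + (d \in I v)) <= #|V| * 2.
    by rewrite -sum_nat_const; apply: leq_sum => v _; have := none v; rewrite leqNgt => /negbFE.
  rewrite !big_split /= !E.
  have := cov a; have := cov b; have := cov c; have := cov d.
  by move: #|V| (#|[set v | a \in I v]|) (#|[set v | b \in I v]|) (#|[set v | c \in I v]|) (#|[set v | d \in I v]|); lia.
have := @indep v.
case av: (a \in I v); case bv: (b \in I v); case cv: (c \in I v); case dv: (d \in I v) => // hv _.
- by have := hv a b c av bv cv; rewrite abc.
- by have := hv a b c av bv cv; rewrite abc.
- by have := hv a b d av bv dv; rewrite abd.
- by have := hv c d a cv dv av; rewrite cda.
- by have := hv c d b cv dv bv; rewrite cdb.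
Qed.

(** If independent sets cover every index more than half of the time, the 3-graph
    [h] resembles a complete bipartite one.  Indeed the completions of a pair in
    an independent set [B] lie outside [B], so [B] has at most about half of the
    indices.  Taking [A] of at least half size, and a second member that covers at
    least half of the complement of [A], in a set [K], pairs in [A] are completed by
    almost all of the complement of [A], and pairs in [K] by at least about half of [A].
    Then some two indices of [A] and two of [K] span a complete 3-graph, against
    [half_cover_no_K4]. *)
Lemma no_independent_half_cover (J V : finType) (I : V -> {set J}) (h : J -> J -> J -> bool) :
  0 < #|J| -> 0 < #|V| -> (forall i, #|V| < 2 * #|[set v | i \in I v]|) ->
  (forall v i j k, i \in I v -> j \in I v -> k \in I v -> ~~ h i j k) ->
  100 * #|deficient h| <= #|J| ^ 2 -> False.
Proof.
set m := #|J| => m0 V0 cov indep few_deficient.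
have K4 a b c d := @half_cover_no_K4 _ _ I h a b c d V0 cov indep.
(* A set of more than a tenth of the indices contains a pair that is not
   deficient, because at most a hundredth of all pairs are. *)
have good_in (B : {set J}) : m ^ 2 < 100 * #|B| ^ 2 ->
    exists i j, [/\ i \in B, j \in B & 49 * m <= 100 * codeg h i j].
  move=> hB; have : #|deficient h| < #|setX B B| by rewrite cardsX mulnn; lia.
  move=> lt; have /subsetPn[[i j]] : ~~ (setX B B \subset deficient h).
    by apply: contraTN lt => /subset_leq_card; rewrite -leqNgt.
  by rewrite !inE /= -leqNgt => /andP[iB jB] g; exists i, j.
have codeg_out v i j : i \in I v -> j \in I v -> [set k | h i j k] \subset ~: I v.
  move=> iI jI; apply/subsetP => k; rewrite !inE; apply: contraTN => kI.
  exact: indep iI jI kI.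
have cardC (B : {set J}) : #|~: B| = m - #|B| by rewrite /m -(cardsC B) addKn.
(* The large independent set A. *)
have [v] := exists_cover [set: J] V0 cov; rewrite setIT cardsT -/m.
set A := I v; set a := #|A| => ma.
have am : a <= m by exact: max_card.
have [i [j [iA jA gij]]] : exists i j, [/\ i \in A, j \in A & 49 * m <= 100 * codeg h i j].
  by apply: good_in; rewrite -/a; nia.
have a51 : 100 * a <= 51 * m.
  have := subset_leq_card (codeg_out v i j iA jA); rewrite cardC -/A -/a -/(codeg h i j).
  lia.
(* The independent set covering half of the complement of A. *)
have [w] := exists_cover (~: A) V0 cov; rewrite cardC -/a.
set K := I w :&: ~: A; set k := #|K| => ak.
have kam : k + a <= m.
  have : k <= #|~: A| by exact/subset_leq_card/subsetIr.
  by rewrite cardC -/a; lia.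
have KA c : c \in K -> c \in I w by rewrite inE => /andP[].
(* Completions of a pair of K avoid the second independent set, hence K; at most
   about a quarter of the indices lie outside A and K, so another quarter of the
   completions are in A. *)
pose N c d := [set x in A | h c d x].
have Nbig c d : c \in K -> d \in K -> (c, d) \notin deficient h -> 47 * m <= 200 * #|N c d|.
  move=> cK dK; rewrite inE -leqNgt /= -/m => g.
  have : codeg h c d <= #|N c d| + #|~: A :\: K|.
    apply: leq_trans (leq_card_setU _ _); apply/subset_leq_card/subsetP => x hx.
    have := subsetP (codeg_out w c d (KA c cK) (KA d dK)) x hx.
    move: hx; rewrite !inE => ->; case: (x \in A) => //=.
    by case: (x \in I w).
  rewrite cardsD cardC -/a (setIidPr (subsetIr _ _)) -/K -/k.
  lia.
(* S counts the quadruples (x, y, c, d) in A^2 x K^2, with c, d not deficient, in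
   which cdx and cdy are edges: from below over c, d and from above over x, y. *)
pose P (cd : J * J) := (cd \in setX K K) && (cd \notin deficient h).
pose R x y : {set J * J} := [set cd | P cd & (x \in N cd.1 cd.2) && (y \in N cd.1 cd.2)].
set S := \sum_(x in A) \sum_(y in A) #|R x y|.
have sumR : S = \sum_(cd | P cd) #|N cd.1 cd.2| ^ 2.
  transitivity (\sum_(x in A) \sum_(y in A) \sum_(cd | P cd)
      (x \in N cd.1 cd.2) * (y \in N cd.1 cd.2)).
    apply: eq_bigr => x _; apply: eq_bigr => y _.
    rewrite -sum1_card [LHS]big_mkcond [RHS]big_mkcond /=; apply: eq_bigr => cd _.
    by rewrite inE; case: (P cd) => //; rewrite mulnb /=; case: ifP.
  under eq_bigr do rewrite exchange_big /=.
  rewrite exchange_big /=; apply: eq_bigr => -[c d] _ /=.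
  have -> : #|N c d| = \sum_(x in A) (x \in N c d).
    rewrite -sum1_card [LHS]big_mkcond [RHS]big_mkcond /=; apply: eq_bigr => x _.
    by rewrite inE; case: (x \in A); case: (h c d x).
  rewrite -mulnn big_distrl /=; apply: eq_bigr => x _.
  by rewrite big_distrr.
have low : 100 * k ^ 2 * (47 * m) ^ 2 <= 100 * (200 ^ 2 * S) + m ^ 2 * (47 * m) ^ 2.
  have cP : k ^ 2 <= #|P| + #|deficient h|.
    rewrite -mulnn -cardsX; apply: (@leq_trans #|[set cd | P cd] :|: deficient h|).
      by apply/subset_leq_card/subsetP => cd cdK; rewrite in_setU in_set /P cdK; case: (cd \in deficient h).
    by rewrite -[#|P|]cardsE leq_card_setU.
  have : #|P| * (47 * m) ^ 2 <= 200 ^ 2 * S.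
    rewrite sumR big_distrr -sum_nat_const; apply: leq_sum => -[c d] /andP[].
    rewrite -[X in _ <= X]expnMn leq_exp2r // inE => /andP[cK dK] g; exact: Nbig.
  move: few_deficient cP; set q := #|P|; set r := #|deficient h|; set u := (47 * m) ^ 2.
  by move: (200 ^ 2 * S) => z; nia.
(* Without a complete 3-graph on x, y, c, d, one of c and d must be among the
   m/100 indices outside A that do not complete x, y. *)
have Rgood x y : x \in A -> y \in A -> (x, y) \notin deficient h -> 100 * #|R x y| <= 2 * k * m.
  move=> xA yA; rewrite inE /= -leqNgt -/m => g.
  set B := K :\: [set c | h x y c].
  have cB : 100 * #|B| <= m.
    have : #|B| <= #|~: A :\: [set c | h x y c]|.
      by apply/subset_leq_card/setSD/subsetIr.
    rewrite cardsD cardC -/a (setIidPr (codeg_out v x y xA yA)) -/(codeg h x y).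
    lia.
  have : #|R x y| <= #|setX B K| + #|setX K B|.
    apply: leq_trans (leq_card_setU _ _); apply/subset_leq_card/subsetP => -[c d].
    rewrite in_set /P /= => /andP[/andP[cdK _]].
    rewrite !inE => /andP[/andP[_ hx] /andP[_ hy]].
    move: (K4 x y c d) cdK; rewrite hx hy !andbT !inE.
    by case: (h x y c); case: (h x y d) => //=; rewrite ?orbT => _ /andP[-> ->].
  by rewrite !cardsX -/k; move: #|B| #|R x y| cB => z t; nia.
have Rbad x y : #|R x y| <= k ^ 2.
  rewrite -mulnn -cardsX; apply/subset_leq_card/subsetP => cd.
  by rewrite inE => /andP[/andP[]].
have high : 100 * S <= 2 * k * m * a ^ 2 + m ^ 2 * k ^ 2.
  pose bd x y : nat := (x, y) \in deficient h.
  have sb : \sum_(x in A) \sum_(y in A) bd x y <= #|deficient h|.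
    rewrite -sum1_card [X in _ <= X]big_mkcond /= pair_big /= big_mkcond.
    by apply: leq_sum => -[x y] _ /=; rewrite /bd; case: ifP => _; case: ifP.
  have : 100 * S <= \sum_(x in A) \sum_(y in A) (2 * k * m + 100 * k ^ 2 * bd x y).
    rewrite /S big_distrr; apply: leq_sum => x xA; rewrite big_distrr; apply: leq_sum => y yA.
    rewrite /bd; case: (boolP ((x, y) \in deficient h)) => [_|g].
      by rewrite muln1 (leq_trans _ (leq_addl _ _)) // leq_mul2l Rbad.
    by rewrite muln0 addn0 Rgood.
  under eq_bigr do rewrite big_split /= sum_nat_const -big_distrr /=.
  rewrite big_split /= sum_nat_const -big_distrr /= -/a.
  move: few_deficient sb; set r := #|deficient h|; move: (\sum_(x in A) _) => z h1 h2.
  have : 100 * k ^ 2 * z <= k ^ 2 * m ^ 2 by nia.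
  by rewrite -mulnn; nia.
(* With a <= .51 m and k >= .245 m, the lower bound for S exceeds the upper one:
   in units of powers of m, (k^2 - .01) .235^2 > .02 .51^2 k + .01 k^2. *)
have k49 : 49 * m <= 200 * k by lia.
have a2 : 100 ^ 2 * a ^ 2 <= 51 ^ 2 * m ^ 2.
  have : (100 * a) ^ 2 <= (51 * m) ^ 2 by rewrite leq_exp2r.
  by rewrite !expnMn.
have key : 8 * 51 ^ 2 * (k * m) + 47 ^ 2 * m ^ 2 + 200 ^ 2 * k ^ 2 < 100 * 47 ^ 2 * k ^ 2.
  by nia.
have a3 : 100 ^ 2 * (k * m * a ^ 2) <= k * m * (51 ^ 2 * m ^ 2).
  by rewrite mulnCA leq_mul2l a2 orbT.
have {}key : m ^ 2 * (8 * 51 ^ 2 * (k * m) + 47 ^ 2 * m ^ 2 + 200 ^ 2 * k ^ 2)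
    < m ^ 2 * (100 * 47 ^ 2 * k ^ 2).
  by rewrite ltn_pmul2l ?key // expn_gt0 m0.
move: low high a3 key; rewrite !expnMn; clear; move: S => S.
by lia.
Qed.

(** * The codegree threshold *)

(** The upper bound.  The sample size [m] is a constant, so one pattern [h] on the
    indices is induced by a positive proportion of the good samples, and a box of
    such samples doubles every index into a pair [p k], [q k].  For a vertex [v] the
    indices whose pair forms an edge with [v] cannot contain an edge of [h], as
    this would give a Fano plane through [v]; and each pair forms an edge with more
    than half of the vertices. *)
Lemma fano_of_codegree :
  exists n0, forall (V : finType) (G : threegraph V), n0 <= #|V| ->
    (forall u w, u != w -> #|V| < 2 * codegree G u w) -> contains_copy G fano.
Proof.
(* m is kept abstract so that the numeral is never evaluated. *)
have [m mbig] : exists m, 600 * (200 * 200) <= m by eexists; exact: leqnn.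
pose J := 'I_m.
have [N boxN] := boxes_in_dense_sets (enum J) (2 * #|{set J * J * J}|).
exists (maxn 600 N) => V G; rewrite geq_max => /andP[V600 VN] dG.
have V0 : 0 < #|V| by lia.
have dG' u w : u != w -> #|V| < 2 * codeg (adj G) u w.
  move=> uw; apply: leq_trans (dG u w uw) _; rewrite leq_mul2l; exact: codegree_adj.
pose S := [set x : {ffun J -> V} | 100 * #|deficient (pull (adj G) x)| <= #|J| ^ 2].
have cS : #|{ffun J -> V}| <= 2 * #|S|.
  by apply: sampling; rewrite ?card_ord // => u w /dG'/ltnW.
pose pat (x : {ffun J -> V}) := [set t : J * J * J | pull (adj G) x t.1.1 t.1.2 t.2].
have [h] : exists h : {set J * J * J}, #|S| <= #|{set J * J * J}| * #|[set x in S | pat x == h]|.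
  apply: exists_sum_ge; first by apply/card_gt0P; exists set0.
  rewrite -big_distrr leq_mul2l; apply/orP; right.
  rewrite -[X in X <= _]sum1_card (partition_big pat xpredT) //=.
  apply: leq_sum => h _; rewrite -[X in _ <= X]sum1_card.
  by rewrite eq_leq //; apply: eq_bigl => x; rewrite inE.
set Sh := [set x in S | _] => cSh.
have : #|{ffun J -> V}| <= 2 * #|{set J * J * J}| * #|Sh|.
  by rewrite -mulnA; apply: leq_trans cS _; rewrite leq_mul2l.
case/(boxN V Sh VN) => p [q [x [pq mix]]].
have {pq} pq k : p k != q k by apply: pq; rewrite mem_enum.
pose y b : {ffun J -> V} := [ffun k => if b k then p k else q k].
have {mix} ySh b : y b \in Sh.
  suff -> : y b = [ffun k => if k \in enum J then if b k then p k else q k else x k].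
    exact: mix.
  by apply/ffunP => k; rewrite !ffunE mem_enum.
pose hh i j k := (i, j, k) \in h.
have pull_hh b i j k : pull (adj G) (y b) i j k = hh i j k.
  by have := ySh b; rewrite inE => /andP[_ /eqP hE]; rewrite /hh -hE inE.
case: (boolP (contains_copy G fano)) => // noF; exfalso.
apply: (@no_independent_half_cover J V (fun v => [set i | adj G v (p i) (q i)]) hh) => //.
- by rewrite card_ord; lia.
- move=> i; apply: leq_trans (dG' _ _ (pq i)) _; rewrite leq_mul2l eq_leq ?orbT //.
  by apply: eq_card => v; rewrite !inE adjCr adjCl.
- move=> v i j k; rewrite !inE => vi vj vk; apply: contra noF => ijk.
  have hmix b : pull (adj G) (y b) i j k by rewrite pull_hh.
  have /and3P[ij ik jk] := adj_uniq (hmix xpredT).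
  apply: (@fano_of_pairs _ G v (fun b => if b then p i else q i)
    (fun b => if b then p j else q j) (fun b => if b then p k else q k)) => // b c d.
  have := hmix (fun l => if l == i then b else if l == j then c else d).
  have {ij ik jk} [ij ik jk] : [/\ i != j, i != k & j != k].
    by split; [apply: contraNneq ij|apply: contraNneq ik|apply: contraNneq jk] => ->.
  rewrite /pull !ffunE !eqxx ![j == _]eq_sym ![k == _]eq_sym.
  by rewrite (negPf ij) (negPf ik) (negPf jk).
- have := ySh xpredT; rewrite !inE => /andP[+ _]; apply: leq_trans.
  rewrite leq_mul2l eq_leq ?orbT //; apply: eq_card => -[i j]; rewrite !inE /=.
  rewrite (_ : codeg hh i j = codeg (pull (adj G) (y xpredT)) i j) //.
  by apply: eq_card => k; rewrite !inE pull_hh.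
Qed.

Theorem theorem1p2 :
  exists n0 : nat, forall n : nat, n0 <= n -> ex2 n fano = n %/ 2.
Proof.
have [n0 fanoP] := fano_of_codegree; exists (maxn 4 n0) => n.
rewrite geq_max => /andP[n4 n0n]; apply/eqP; rewrite eqn_leq; apply/andP; split.
  apply/bigmax_leqP => G; apply: contraR; rewrite -ltnNge => dG.
  apply: fanoP; rewrite card_ord // => u w uw.
  by have := leq_trans dG (delta2_le G uw); move: (codegree G u w); lia.
(* The smaller class has n %/ 2 vertices. *)
pose A := [set i : 'I_n | i < n %/ 2].
have cA : #|A| = n %/ 2.
  rewrite -[RHS]card_ord -[RHS]sum1_card -[LHS]sum1_card.
  rewrite (big_ord_widen n (fun=> 1)) ?leq_div //.
  by apply: eq_bigl => i; rewrite inE.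
apply: leq_trans (@leq_bigmax_cond _ _ _ (crossing A) (crossing_fano_free A)).
apply: crossing_delta2; rewrite ?cA //; last by rewrite card_ord; lia.
have := cardsC A; rewrite card_ord cA; move: #|~: A|; lia.
Qed.
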